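(* Let $n\ge4$ and let $\mathbf z_{\mathrm{CM}}=(z_\alpha)_{\alpha\in I_n^{\mathrm{CM}}}$ be a coherent Cayley-Menger frieze of order $n$ such that (i) $z_{(i,j)}\ne0$ for all $(i,j)\in\mathbb Z^2$ with $2\le j-i\le n-2$; (ii) $H(z_{(i,j)},z_{(i+1,j)},z_{(i+\frac12,/)})\ne0$ and $H(z_{(i,j-1)},z_{(i,j)},z_{(\backslash,j-\frac12)})\ne0$ for all $(i,j)\in\mathbb Z^2$ with $2\le j-i\le n-1$. Then there exists an $n$-gon $P$ in the plane $\mathbf A$ such that $\mathbf z_{\mathrm{CM}}=\mathbf z_{\mathrm{CM}}(P)$. Consequently $\mathbf z_{\mathrm{CM}}$ has the glide symmetry: $z_{(i,j)}=z_{(j,i+n)}$ for all $(i,j)\in\mathbb Z^2$ with $1\le j-i\le n-1$.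
   Context: $\mathbf A=\mathbb C^2$; for points $A,B\in\mathbf A$, $x(A,B)=\langle\overrightarrow{AB},\overrightarrow{AB}\rangle$ where $\langle u,v\rangle=u'v'+u''v''$ (complex bilinear). An $n$-gon is an $n$-tuple $P=(A_1,\dots,A_n)\in\mathbf A^n$; $x_{ij}=x(A_i,A_j)$ (so $x_{ii}=0$). $H(p,q,r)=-p^2-q^2-r^2+2pq+2pr+2qr$. The Cayley-Menger polynomial is $$M(a,b,c,d,e,f)=\det\begin{bmatrix}0&1&1&1&1\\1&0&b&e&a\\1&b&0&c&f\\1&e&c&0&d\\1&a&f&d&0\end{bmatrix}.$$ A Cayley-Menger diamond is a 6-tuple $(a,b,c,d,e,f)\in\mathbb C^6$ with $M(a,b,c,d,e,f)=0$. Notation: $\partial_\uparrow M=\partial M/\partial a$, $\partial_\downarrow M=\partial M/\partial c$, $\partial_\leftarrow M=\partial M/\partial e$, $\partial_\rightarrow M=\partial M/\partial f$. For $n\ge4$ let $L_n=\{(i+\frac12,/):i\in\mathbb Z\}\cup\{(\backslash,j+\frac12):j\in\mathbb Z\}$ (formal indices) and $I_n^{\mathrm{CM}}=\{(i,j)\in\mathbb Z^2:0\le j-i\le n\}\cup L_n$. For an array $\mathbf z=(z_\alpha)_{\alpha\in I_n^{\mathrm{CM}}}$ of complex numbers and $(i,j)\in\mathbb Z^2$ with $1\le j-i\le n-1$ put $$\Diamond_{i,j}(\mathbf z)=(z_{(i,j+1)},z_{(i+\frac12,/)},z_{(i+1,j)},z_{(\backslash,j+\frac12)},z_{(i,j)},z_{(i+1,j+1)}).$$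 A Cayley-Menger frieze of order $n$ is such an array in which every $\Diamond_{i,j}(\mathbf z)$, $1\le j-i\le n-1$, is a Cayley-Menger diamond and, for all $i\in\mathbb Z$: $z_{(i,i)}=0$, $z_{(i,i+1)}=z_{(i+\frac12,/)}=z_{(\backslash,i+\frac12)}$, $z_{(i,i+n)}=0$, $z_{(i,i+n-1)}=z_{(i-\frac12,/)}=z_{(\backslash,i+n-\frac12)}$. It is coherent if for all $(i,j)\in\mathbb Z^2$ with $2\le j-i\le n-2$ $$\partial_\leftarrow M(\Diamond_{i-1,j-1}(\mathbf z))\,\partial_\rightarrow M(\Diamond_{i,j}(\mathbf z))=\partial_\uparrow M(\Diamond_{i-1,j}(\mathbf z))\,\partial_\downarrow M(\Diamond_{i,j-1}(\mathbf z)).$$ The Cayley-Menger frieze $\mathbf z_{\mathrm{CM}}(P)$ of an $n$-gon $P$ is defined by $z_{(i,j)}=x_{\langle i\rangle\langle j\rangle}$, $z_{(i+\frac12,/)}=x_{\langle i\rangle\langle i+1\rangle}$, $z_{(\backslash,j+\frac12)}=x_{\langle j\rangle\langle j+1\rangle}$, where $\langle m\rangle\in\{1,\dots,n\}$ is the residue of $m$ mod $n$. *)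

(* Defs.v *)
(* The complex field is R[i] for an arbitrary R : realType. *)
From mathcomp Require Import all_boot all_order all_algebra.
From mathcomp Require Import reals complex.

Set Implicit Arguments.
Unset Strict Implicit.
Unset Printing Implicit Defensive.

Import Order.TTheory GRing.Theory Num.Theory.
Local Open Scope ring_scope.

Section CayleyMenger.
Variable K : comNzRingType.
Implicit Types a b c d e f p q r : K.

Definition Hpoly p q r : K :=
  - p ^+ 2 - q ^+ 2 - r ^+ 2 + 2 * p * q + 2 * p * r + 2 * q * r.

Definition CMmatrix a b c d e f : 'M[K]_5 :=
  \matrix_(i < 5, j < 5)
    (nth [::] [:: [:: 0; 1; 1; 1; 1];
                  [:: 1; 0; b; e; a];
                  [:: 1; b; 0; c; f];
                  [:: 1; e; c; 0; d];
                  [:: 1; a; f; d; 0]] i)`_j.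

Definition CM a b c d e f : K := \det (CMmatrix a b c d e f).

End CayleyMenger.

(* Sextuples are ordered (a, b, c, d, e, f). *)
Definition sextuple (K : Type) : Type := (K * K * K * K * K * K)%type.

Section Diamond.
Variable K : comNzRingType.
Implicit Type D : sextuple K.

Definition is_CM_diamond D : Prop :=
  let: (a, b, c, d, e, f) := D in CM a b c d e f = 0.

(* Formal partial derivatives: CM is evaluated over {poly K} with 'X in the
   slot of the distinguished variable and constants in the other slots. *)
Definition dCM_up D : K :=
  let: (a, b, c, d, e, f) := D in
  (CM 'X b%:P c%:P d%:P e%:P f%:P)^`().[a].

Definition dCM_down D : K :=
  let: (a, b, c, d, e, f) := D in
  (CM a%:P b%:P 'X d%:P e%:P f%:P)^`().[c].

Definition dCM_left D : K :=
  let: (a, b, c, d, e, f) := D in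
  (CM a%:P b%:P c%:P d%:P 'X f%:P)^`().[e].

Definition dCM_right D : K :=
  let: (a, b, c, d, e, f) := D in
  (CM a%:P b%:P c%:P d%:P e%:P 'X)^`().[f].

End Diamond.

(* [node i j] is (i, j), [slash i] is (i + 1/2, /) and
   [backslash j] is (\, j + 1/2). *)
Inductive CM_index : Type :=
  | node of int & int
  | slash of int
  | backslash of int.

Definition ICM (n : nat) : pred CM_index := fun alpha =>
  match alpha with
  | node i j => 0 <= j - i <= n%:Z
  | slash _ | backslash _ => true
  end.

(* An array indexed by I_n^CM is represented by a function on all of CM_index;
   its values at nodes outside [ICM n] are never constrained, and two arrays are
   identified when they agree on [ICM n]. *)
Definition CM_array (K : Type) : Type := CM_index -> K.

Section Frieze.
Variables (K : comNzRingType) (n : nat).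
Implicit Type z : CM_array K.

Definition diamond z (i j : int) : sextuple K :=
  (z (node i (j + 1)), z (slash i), z (node (i + 1) j), z (backslash j),
   z (node i j), z (node (i + 1) (j + 1))).

Record is_CM_frieze z : Prop := IsCMFrieze {
  CM_frieze_diamond : forall i j : int, 1 <= j - i <= n%:Z - 1 ->
    is_CM_diamond (diamond z i j);
  CM_frieze_diag0 : forall i : int, z (node i i) = 0;
  CM_frieze_bottom : forall i : int,
    z (node i (i + 1)) = z (slash i) /\ z (slash i) = z (backslash i);
  CM_frieze_diagn : forall i : int, z (node i (i + n%:Z)) = 0;
  CM_frieze_top : forall i : int,
    z (node i (i + n%:Z - 1)) = z (slash (i - 1)) /\
    z (slash (i - 1)) = z (backslash (i + n%:Z - 1))
}.

Definition coherent z : Prop :=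
  forall i j : int, 2 <= j - i <= n%:Z - 2 ->
    dCM_left (diamond z (i - 1) (j - 1)) * dCM_right (diamond z i j) =
    dCM_up (diamond z (i - 1) j) * dCM_down (diamond z i (j - 1)).

End Frieze.

Section Polygon.
Variable K : comNzRingType.
Implicit Types u v A B : 'rV[K]_2.

(* Bilinear, without conjugation. *)
Definition dotp u v : K := u 0 0 * v 0 0 + u 0 1 * v 0 1.

Definition sqdist A B : K := dotp (B - A) (B - A).

Definition polygon (n : nat) : Type := n.-tuple 'rV[K]_2.

(* The tuple is 0-indexed: [vertex P k] is A_k for 1 <= k <= n. *)
Definition vertex (n : nat) (P : polygon n) (k : nat) : 'rV[K]_2 :=
  nth 0 P k.-1.

(* The representative of m mod n in {1, ..., n}, for n > 0. *)
Definition residue (n : nat) (m : int) : nat := `|((m - 1) %% n%:Z)%Z|.+1.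

Definition frieze_of_polygon (n : nat) (P : polygon n) : CM_array K :=
  let x k l := sqdist (vertex P (residue n k)) (vertex P (residue n l)) in
  fun alpha =>
  match alpha with
  | node i j => x i j
  | slash i => x i (i + 1)
  | backslash j => x j (j + 1)
  end.

End Polygon.

(* Main.v *)
Require Import Defs.
From mathcomp Require Import all_boot all_order all_algebra ring zify.
From mathcomp Require Import reals complex.

Set Implicit Arguments.
Unset Strict Implicit.
Unset Printing Implicit Defensive.

Import Order.TTheory GRing.Theory Num.Theory.
Local Open Scope ring_scope.

(* Fix i. Starting from a triangle A_i A_(i+1) A_(i+2), every next point
   A_(j+1) is the unique planar point prescribed by the diamond (i, j), the
   triangle A_i A_(i+1) A_j being nondegenerate; closing up n-periodically,
   rows i and i + 1 of the frieze are distances between the points. All other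
   rows i' > i follow: the derivatives in the coherence relation are products
   of two oriented triangle areas, so the relation holds for planar points
   too, and it determines dCM_right of the diamond (i + 1, j), an affine
   function of z_(i+2,j+1) with slope -4 z_(i+1,j) <> 0. Since i is arbitrary,
   z is n-periodic, and a polygon realizing the rows i >= 0 realizes all rows.
   *)

(** * Expansion of the Cayley-Menger determinant *)

(** Entries indexed by natural numbers let a concrete determinant unfold by simplification. *)
Fixpoint laplace (K : comNzRingType) n (F : nat -> nat -> K) : K :=
  if n is m.+1 then
    foldr (fun j s =>
      (-1) ^+ j * F 0 j * laplace m (fun i k => F i.+1 (bump j k)) + s)
      0 (iota 0 m.+1)
  else 1.

Lemma det_laplace (K : comNzRingType) n (F : nat -> nat -> K) :
  \det (\matrix_(i < n, j < n) F i j) = laplace n F.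
Proof.
elim: n F => [|n IHn] F; first by rewrite det_mx00.
rewrite (expand_det_row _ ord0) [RHS]/=.
pose G j := (-1) ^+ j * F 0 j * laplace n (fun i k => F i.+1 (bump j k)).
(* Unlocking the big sum exposes the [foldr] over [iota] of [laplace]. *)
transitivity (\sum_(0 <= j < n.+1) G j); last by rewrite unlock.
rewrite big_mkord; apply: eq_bigr => j _.
rewrite mxE /cofactor mulrA /G [_ * F 0 j]mulrC -IHn; congr (_ * _ * \det _).
by apply/matrixP => i k; rewrite !mxE.
Qed.

Lemma CME (K : comNzRingType) (a b c d e f : K) : CM a b c d e f =
  - 2 * (a ^+ 2 * c + a * c ^+ 2 + b ^+ 2 * d + b * d ^+ 2 + e ^+ 2 * f
         + e * f ^+ 2 + a * b * f + c * d * f + a * d * e + b * c * e)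
  + 2 * (a * b * c + a * b * d + a * c * d + a * c * e + a * c * f + a * e * f
         + b * c * d + b * d * e + b * d * f + b * e * f + c * e * f
         + d * e * f).
Proof.
rewrite /CM /CMmatrix (det_laplace 5 (fun i j => (nth [::] _ i)`_j)).
rewrite /= /bump /=.
ring.
Qed.

(** * Oriented areas and Cayley-Menger derivatives of planar points *)

Section Planar.
Variable K : comNzRingType.
Implicit Types p q r s : 'rV[K]_2.

(** Twice the oriented area of the triangle. *)
Definition cross p q r : K :=
  (q 0 0 - p 0 0) * (r 0 1 - p 0 1) - (q 0 1 - p 0 1) * (r 0 0 - p 0 0).

Definition planar_diamond p q r s : sextuple K :=
  (sqdist p s, sqdist p q, sqdist q r, sqdist r s, sqdist p r, sqdist q s).

Lemma sqdistE p q :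
  sqdist p q = (q 0 0 - p 0 0) ^+ 2 + (q 0 1 - p 0 1) ^+ 2.
Proof. by rewrite /sqdist /dotp !mxE !expr2. Qed.

Lemma sqdistC p q : sqdist p q = sqdist q p.
Proof. by rewrite !sqdistE; ring. Qed.

Lemma sqdistxx p : sqdist p p = 0.
Proof. by rewrite sqdistE; ring. Qed.

(** Heron's formula: both sides are 16 times the squared area. Hypothesis (ii) thus becomes
    nondegeneracy of triangles. *)
Lemma Hpoly_planar p q r :
  Hpoly (sqdist p r) (sqdist q r) (sqdist p q) = 4 * cross p q r ^+ 2.
Proof. by rewrite /Hpoly /cross !sqdistE; ring. Qed.

Lemma cross_rot p q r : cross p q r = cross q r p.
Proof. by rewrite /cross; ring. Qed.

Lemma dCM_upE (a b c d e f : K) : dCM_up (a, b, c, d, e, f) =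
  - 4 * c * a + 2 * (b * c + b * d - b * f - c ^+ 2 + c * d + c * e + c * f
                     - d * e + e * f).
Proof. by rewrite /dCM_up CME !(derivE, hornerE) /=; ring. Qed.

(* The symmetries of the Cayley-Menger polynomial under relabelling of the
   points reduce the other derivatives to the first one. *)
Lemma dCM_downE (a b c d e f : K) :
  dCM_down (a, b, c, d, e, f) = dCM_up (c, b, a, d, f, e).
Proof.
rewrite /dCM_down /dCM_up; congr (_^`()).[_].
by rewrite !CME; ring.
Qed.

Lemma dCM_leftE (a b c d e f : K) :
  dCM_left (a, b, c, d, e, f) = dCM_up (e, b, f, d, a, c).
Proof.
rewrite /dCM_left /dCM_up; congr (_^`()).[_].
by rewrite !CME; ring.
Qed.

Lemma dCM_rightE (a b c d e f : K) :
  dCM_right (a, b, c, d, e, f) = dCM_up (f, b, e, d, c, a).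
Proof.
rewrite /dCM_right /dCM_up; congr (_^`()).[_].
by rewrite !CME; ring.
Qed.

(** In this and the next three formulas, the two triangles share the edge opposite to the variable
    one. *)
Lemma dCM_up_planar p q r s :
  dCM_up (planar_diamond p q r s) = 8 * cross p q r * cross q r s.
Proof. by rewrite dCM_upE !sqdistE /cross; ring. Qed.

Lemma dCM_down_planar p q r s :
  dCM_down (planar_diamond p q r s) = 8 * cross p q s * cross p r s.
Proof. by rewrite dCM_downE dCM_upE !sqdistE /cross; ring. Qed.

Lemma dCM_left_planar p q r s :
  dCM_left (planar_diamond p q r s) = - 8 * cross p q s * cross q r s.
Proof. by rewrite dCM_leftE dCM_upE !sqdistE /cross; ring. Qed.

Lemma dCM_right_planar p q r s :
  dCM_right (planar_diamond p q r s) = - 8 * cross p q r * cross p r s.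
Proof. by rewrite dCM_rightE dCM_upE !sqdistE /cross; ring. Qed.
End Planar.

(** * Points with prescribed squared distances *)

Section Construction.
Variable K : numClosedFieldType.
Implicit Types p q r s : 'rV[K]_2.

Definition pt (x y : K) : 'rV[K]_2 := \row_(j < 2) if j == 0 then x else y.

Lemma ptx x y : pt x y 0 0 = x. Proof. by rewrite mxE. Qed.
Lemma pty x y : pt x y 0 1 = y. Proof. by rewrite mxE. Qed.

(* As [e] is nonzero, the side [pr] can be put on the first axis. *)
Lemma triangle_exists (b c e : K) : e != 0 ->
  exists p q r, [/\ sqdist p q = b, sqdist q r = c & sqdist p r = e].
Proof.
(* With [p] at the origin and [r] at [(h, 0)], the law of cosines forces the abscissa [m] of [q]. *)
move=> e0; set h := sqrtC e; set m := (b + e - c) / 2 / h.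
have hh : h ^+ 2 = e by exact: sqrtCK.
have h0 : h != 0 by rewrite -sqrf_eq0 hh.
have kk := sqrtCK (b - m ^+ 2).
set k := sqrtC _ in kk.
exists (pt 0 0), (pt m k), (pt h 0); rewrite !sqdistE !ptx !pty !subr0 kk.
have mh : 2 * m * h = b + e - c.
  by rewrite /m; field.
split; first by ring.
- have -> : c = b + e - 2 * m * h by rewrite mh; ring.
  by rewrite sub0r sqrrN kk -hh; ring.
- by rewrite hh; ring.
Qed.

(* A point of the plane is determined by its inner products with two independent
   vectors; the vanishing of the Cayley-Menger determinant makes the third
   distance come out right. *)
Lemma extension_exists (a d f : K) p q r : cross p q r != 0 ->
  CM a (sqdist p q) (sqdist q r) d (sqdist p r) f = 0 ->
  exists s, [/\ sqdist p s = a, sqdist q s = f & sqdist r s = d].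
Proof.
move=> D0 M0.
(* By polarization, these must be the inner products of [s - p] with [q - p] and [r - p]. *)
set m := (a + sqdist p q - f) / 2; set k := (a + sqdist p r - d) / 2.
pose u1 := q 0 0 - p 0 0; pose u2 := q 0 1 - p 0 1.
pose v1 := r 0 0 - p 0 0; pose v2 := r 0 1 - p 0 1.
(* Cramer's rule for the coordinates of [s - p]. *)
pose x := (m * v2 - k * u2) / cross p q r.
pose y := (k * u1 - m * v1) / cross p q r.
have um : x * u1 + y * u2 = m.
  by rewrite /x /y /u1 /u2 /v1 /v2 /cross; field; exact: D0.
have vk : x * v1 + y * v2 = k.
  by rewrite /x /y /u1 /u2 /v1 /v2 /cross; field; exact: D0.
have wa : x ^+ 2 + y ^+ 2 = a.
  apply/esym/eqP; rewrite -subr_eq0.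
  (* Once [f] and [d] are eliminated, the left side is the Cayley-Menger determinant. *)
  have : 8 * cross p q r ^+ 2 * (a - (x ^+ 2 + y ^+ 2)) = 0.
    have fE : f = a + sqdist p q - 2 * (x * u1 + y * u2).
      by rewrite um /m; field.
    have dE : d = a + sqdist p r - 2 * (x * v1 + y * v2).
      by rewrite vk /k; field.
    rewrite -[RHS]M0 CME fE dE !sqdistE /cross /u1 /u2 /v1 /v2.
    ring.
  move/eqP; rewrite mulf_eq0 => /orP[|//].
  by rewrite mulf_eq0 expf_eq0 /= (negPf D0) pnatr_eq0.
exists (pt (p 0 0 + x) (p 0 1 + y)); rewrite 3!sqdistE !ptx !pty; split.
- by rewrite -wa; ring.
- have -> : f = a + sqdist p q - 2 * m by rewrite /m; field.
  by rewrite -wa -um sqdistE /u1 /u2; ring.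
- have -> : d = a + sqdist p r - 2 * k by rewrite /k; field.
  by rewrite -wa -vk sqdistE /v1 /v2; ring.
Qed.
End Construction.

Lemma periodicZ (T : Type) (f : int -> T) (N : int) :
  (forall j, f (j + N) = f j) -> forall q j, f (j + q * N) = f j.
Proof.
move=> fN; have fNn (k : nat) j : f (j + k%:Z * N) = f j.
  elim: k => [|k IH]; first by rewrite mul0r addr0.
  by rewrite intS mulrDl mul1r addrCA addrC fN.
case=> k j; first exact: fNn.
by rewrite NegzE mulNr -(fNn k.+1) subrK.
Qed.

(** * Boundary conditions and realized rows *)

Section Realization.
Variables (K : numClosedFieldType) (n : nat) (z : CM_array K).
Hypothesis n_ge4 : (4 <= n)%N.
Hypothesis frieze_z : is_CM_frieze n z.
Hypothesis coherent_z : coherent n z.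
Hypothesis z_neq0 :
  forall i j : int, 2 <= j - i <= n%:Z - 2 -> z (node i j) != 0.
Hypothesis H_neq0 : forall i j : int, 2 <= j - i <= n%:Z - 1 ->
  Hpoly (z (node i j)) (z (node (i + 1) j)) (z (slash i)) != 0 /\
  Hpoly (z (node i (j - 1))) (z (node i j)) (z (backslash (j - 1))) != 0.
Implicit Type A : int -> 'rV[K]_2.

Lemma slash_node (i : int) : z (slash i) = z (node i (i + 1)).
Proof. by have [] := CM_frieze_bottom frieze_z i. Qed.

Lemma backslash_node (i : int) : z (backslash i) = z (node i (i + 1)).
Proof. by have [-> <-] := CM_frieze_bottom frieze_z i. Qed.

Lemma node_top (i j : int) : j = i + n%:Z ->
  z (node (i + 1) j) = z (node i (i + 1)).
Proof.
move=> ->; have [] := CM_frieze_top frieze_z (i + 1).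
by rewrite (addrAC i 1) !addrK => -> _; rewrite slash_node.
Qed.

(** The top boundary condition equates the slash at [i] with the backslash at [i + n], and both are
    bottom edges. *)
Lemma edge_periodic (i : int) :
  z (node (i + n%:Z) (i + n%:Z + 1)) = z (node i (i + 1)).
Proof.
have [_] := CM_frieze_top frieze_z (i + 1).
by rewrite (addrAC i 1 n) !addrK slash_node backslash_node => ->.
Qed.

Lemma coherent_shift (i j : int) : 3 <= j - i <= n%:Z - 1 ->
  dCM_left (diamond z i (j - 1)) * dCM_right (diamond z (i + 1) j) =
  dCM_up (diamond z i j) * dCM_down (diamond z (i + 1) (j - 1)).
Proof.
move=> ij; have := coherent_z (i := i + 1) (j := j).
by rewrite addrK; apply; lia.
Qed.

Definition row A (i : int) : Prop := forall j : int, 0 <= j - i <= n%:Z ->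
  z (node i j) = sqdist (A i) (A j).

(** Polygons are unrolled to periodic sequences on the integers, which spares most computations
    modulo [n]. *)
Definition closed_polygon A : Prop :=
  (forall i : int, A (i + n%:Z) = A i) /\
  (forall i : int, z (node i (i + 1)) = sqdist (A i) (A (i + 1))).

Lemma diamond_row A (i j : int) :
    closed_polygon A -> row A i -> row A (i + 1) -> 1 <= j - i <= n%:Z - 1 ->
  diamond z i j = planar_diamond (A i) (A (i + 1)) (A j) (A (j + 1)).
Proof.
move=> [_ edge] ri ri1 ij.
rewrite /diamond /planar_diamond slash_node backslash_node !edge.
by rewrite !ri ?ri1 //; lia.
Qed.

(** * Propagation of rows by coherence *)

(** Strong induction along the new row. The offsets 0, 1, [n - 1] and [n] are boundary values; at
    any other, coherence relates four diamonds in which only the new entry is unknown. *)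
Lemma row_next A (i : int) : closed_polygon A -> row A i -> row A (i + 1) ->
  row A (i + 1 + 1).
Proof.
move=> cA ri ri1; have [per edge] := cA.
suff rowk : forall k : nat, (k <= n)%N ->
    z (node (i + 1 + 1) (i + 1 + 1 + k%:Z)) =
    sqdist (A (i + 1 + 1)) (A (i + 1 + 1 + k%:Z)).
  move=> j ij; have -> : j = i + 1 + 1 + (absz (j - (i + 1 + 1))%R)%:Z by lia.
  by apply: rowk; lia.
elim/ltn_ind => -[|[|k]] IH kn.
- by rewrite addr0 sqdistxx (CM_frieze_diag0 frieze_z).
- exact: edge.
have [kE|kn'] := eqVneq k.+2 n.
  by rewrite kE per sqdistxx (CM_frieze_diagn frieze_z).
have [kE|kn''] := eqVneq k.+3 n.
  have -> : i + 1 + 1 + k.+2%:Z = i + 1 + n%:Z by lia.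
  by rewrite node_top // per edge sqdistC.
pose j := i + 1 + 1 + k.+1%:Z.
have -> : i + 1 + 1 + k.+2%:Z = j + 1 by rewrite /j; lia.
have jE : j - 1 + 1 = j by rewrite subrK.
have zc : z (node (i + 1 + 1) (j - 1)) = sqdist (A (i + 1 + 1)) (A (j - 1)).
  have -> : j - 1 = i + 1 + 1 + k%:Z by rewrite /j; lia.
  by apply: IH; lia.
have zf : z (node (i + 1 + 1) j) = sqdist (A (i + 1 + 1)) (A j).
  by apply: IH; lia.
have coh : dCM_left (diamond z i (j - 1)) * dCM_right (diamond z (i + 1) j) =
    dCM_up (diamond z i j) * dCM_down (diamond z (i + 1) (j - 1)).
  by apply: coherent_shift; rewrite /j; lia.
have D1 : diamond z i (j - 1) =
    planar_diamond (A i) (A (i + 1)) (A (j - 1)) (A j).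
  by rewrite (diamond_row cA) ?jE //; rewrite /j; lia.
have D2 : diamond z i j = planar_diamond (A i) (A (i + 1)) (A j) (A (j + 1)).
  by rewrite (diamond_row cA) //; rewrite /j; lia.
have D3 : diamond z (i + 1) (j - 1) =
    planar_diamond (A (i + 1)) (A (i + 1 + 1)) (A (j - 1)) (A j).
  rewrite /diamond /planar_diamond slash_node backslash_node !edge jE zc zf.
  by rewrite !ri1 //; rewrite /j; lia.
(* By Heron's formula, (ii) makes the areas to be cancelled nonzero. *)
have cross1 : cross (A i) (A (i + 1)) (A j) != 0.
  have /H_neq0[+ _] : 2 <= j - i <= n%:Z - 1 by rewrite /j; lia.
  rewrite slash_node edge ri ?ri1; try (rewrite /j; lia).
  by rewrite Hpoly_planar; apply: contraNneq => ->; rewrite expr0n mulr0.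
have cross2 : cross (A (i + 1)) (A (j - 1)) (A j) != 0.
  have /H_neq0[_] : 2 <= j - (i + 1) <= n%:Z - 1 by rewrite /j; lia.
  rewrite backslash_node edge !ri1; try (rewrite /j; lia).
  rewrite jE ![sqdist (A (i + 1)) _]sqdistC Hpoly_planar -cross_rot.
  by apply: contraNneq => ->; rewrite expr0n mulr0.
move: coh; rewrite D1 D2 D3 dCM_left_planar dCM_up_planar dCM_down_planar.
have e0 : sqdist (A (i + 1)) (A j) != 0.
  by rewrite -ri1 ?z_neq0 // /j; lia.
(* Coherence for planar points: the four areas regroup so that both sides of the relation share the
   factor in [dCM_left]. *)
have -> : 8 * cross (A i) (A (i + 1)) (A j) *
      cross (A (i + 1)) (A j) (A (j + 1)) *
      (8 * cross (A (i + 1)) (A (i + 1 + 1)) (A j) *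
        cross (A (i + 1)) (A (j - 1)) (A j)) =
    - 8 * cross (A i) (A (i + 1)) (A j) *
      cross (A (i + 1)) (A (j - 1)) (A j) *
    dCM_right (planar_diamond (A (i + 1)) (A (i + 1 + 1)) (A j) (A (j + 1))).
  by rewrite dCM_right_planar; ring.
have L0 : - 8 * cross (A i) (A (i + 1)) (A j) *
    cross (A (i + 1)) (A (j - 1)) (A j) != 0.
  by rewrite !mulf_neq0 ?oppr_eq0 ?pnatr_eq0.
move=> /(mulfI L0).
rewrite /diamond /planar_diamond !dCM_rightE !dCM_upE.
rewrite slash_node backslash_node !edge zf !ri1; try (rewrite /j; lia).
set e := sqdist (A (i + 1)) (A j) in e0 *.
set y := sqdist (A (i + 1 + 1)) (A (j + 1)).
move=> zy.
(* This is the difference of the two values of [dCM_right], which is affine in its last entry. *)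
suff : - 4 * e * (z (node (i + 1 + 1) (j + 1)) - y) = 0.
  move/eqP; rewrite !mulf_eq0 oppr_eq0 pnatr_eq0 (negPf e0) /= subr_eq0.
  by move/eqP.
move/eqP: zy; rewrite -subr_eq0 => /eqP zy; rewrite -[RHS]zy.
ring.
Qed.

(** * Construction of two initial rows *)

(** Here [B k] stands for the vertex of index [i + k]. The second clause omits [k = 0], where the
    node lies outside the index set. *)
Definition fan (B : nat -> 'rV[K]_2) (i : int) (m : nat) : Prop :=
  [/\ forall k, (k < m)%N -> z (node i (i + k%:Z)) = sqdist (B 0%N) (B k),
      forall k, (0 < k < m)%N ->
        z (node (i + 1) (i + k%:Z)) = sqdist (B 1%N) (B k)
    & forall k, (k.+1 < m)%N ->
        z (node (i + k%:Z) (i + k%:Z + 1)) = sqdist (B k) (B k.+1)].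

(** The first triangle exists because its side from [i] to [i + 2] is nonzero by (i), applicable as
    [n] is at least 4. *)
Lemma fan3 (i : int) : exists B, fan B i 3.
Proof.
have e0 : z (node i (i + 2)) != 0 by apply: z_neq0; lia.
have [p [q [r [pq qr pr]]]] := triangle_exists (z (node i (i + 1)))
  (z (node (i + 1) (i + 2))) e0.
have i2 : i + 1 + 1 = i + 2 by lia.
exists (nth p [:: p; q; r]); split.
- move=> [|[|[|//]]] _ /=; rewrite ?addr0 ?sqdistxx //.
  exact: CM_frieze_diag0 frieze_z i.
- move=> [//|[|[|//]]] _ //=; rewrite sqdistxx.
  exact: CM_frieze_diag0 frieze_z (i + 1).
- by move=> [|[|//]] _ /=; rewrite ?addr0 ?i2.
Qed.

Lemma fanS B (i : int) m : (2 < m < n)%N -> fan B i m ->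
  exists B', fan B' i m.+1.
Proof.
case: m => // m mn [B0 B1 Be].
(* After the case split, [m] is the index of the last point already placed. *)
pose j := i + m%:Z.
have jE : i + m.+1%:Z = j + 1 by rewrite /j; lia.
have i1 : z (node i (i + 1)) = sqdist (B 0) (B 1) by apply: (B0 1%N); lia.
have ij : z (node i j) = sqdist (B 0) (B m) by apply: B0; lia.
have i1j : z (node (i + 1) j) = sqdist (B 1) (B m) by apply: B1; lia.
have cr : cross (B 0) (B 1) (B m) != 0.
  have /H_neq0[+ _] : 2 <= j - i <= n%:Z - 1 by rewrite /j; lia.
  rewrite slash_node i1 ij i1j Hpoly_planar.
  by apply: contraNneq => ->; rewrite expr0n mulr0.
have [s [s0 s1 sm]] : exists s,
    [/\ sqdist (B 0) s = z (node i (j + 1)),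
        sqdist (B 1) s = z (node (i + 1) (j + 1))
      & sqdist (B m) s = z (node j (j + 1))].
  apply: extension_exists cr _.
  have /(CM_frieze_diamond frieze_z) : 1 <= j - i <= n%:Z - 1.
    by rewrite /j; lia.
  by rewrite /is_CM_diamond /diamond slash_node backslash_node i1 ij i1j.
pose B' k := if k == m.+1 then s else B k.
have B'm : B' m.+1 = s by rewrite /B' eqxx.
have B'k k : (k < m.+1)%N -> B' k = B k by rewrite /B'; case: eqP => //; lia.
exists B'; split => k km.
- rewrite (B'k 0%N) //.
  have [->|km'] := eqVneq k m.+1; first by rewrite B'm jE s0.
  by rewrite B'k ?B0 //; lia.
- rewrite (B'k 1%N); last by lia.
  have [->|km'] := eqVneq k m.+1; first by rewrite B'm jE s1.
  by rewrite B'k ?B1 //; lia.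
- rewrite (B'k k); last by lia.
  have [->|km'] := eqVneq k m; first by rewrite B'm sm.
  by rewrite B'k ?Be //; lia.
Qed.

Lemma fann (i : int) : exists B, fan B i n.
Proof.
suff fanm m : (2 < m <= n)%N -> exists B, fan B i m by apply: fanm; lia.
elim: m => // m IH mn; have [->|m2] := eqVneq m 2; first exact: fan3.
have [B fB] : exists B, fan B i m by apply: IH; lia.
by apply: fanS fB; lia.
Qed.

Lemma first_rows (i : int) :
  exists A, [/\ closed_polygon A, row A i & row A (i + 1)].
Proof.
have [B [B0 B1 Be]] := fann i.
pose A (j : int) := B (absz ((j - i)%R %% n%:Z)%Z).
have per (j : int) : A (j + n%:Z) = A j by rewrite /A addrAC modzDr.
have AE (k : nat) : (k < n)%N -> A (i + k%:Z) = B k.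
  by move=> kn; rewrite /A addrAC subrr add0r modz_small //; lia.
have AO : A i = B 0%N by rewrite -AE ?addr0 //; lia.
have A1 : A (i + 1) = B 1%N by rewrite -AE //; lia.
have n1 : i + n.-1%:Z + 1 = i + n%:Z by lia.
(* The closing edge is not in the fan; the boundary conditions equate both sides with the edge from
   [i - 1] to [i]. *)
have zn : z (node i (i + n.-1%:Z)) = z (node (i + n.-1%:Z) (i + n%:Z)).
  have := edge_periodic (i - 1); rewrite subrK.
  have -> : i - 1 + n%:Z = i + n.-1%:Z by lia.
  rewrite n1 => ->.
  by have := @node_top (i - 1) (i + n.-1%:Z); rewrite subrK; apply; lia.
have edge_i (k : nat) : (k < n)%N ->
    z (node (i + k%:Z) (i + k%:Z + 1)) =
    sqdist (A (i + k%:Z)) (A (i + k%:Z + 1)).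
  move=> kn; have [kE|kn'] := eqVneq k.+1 n.
    have -> : k = n.-1 by lia.
    rewrite n1 per -zn B0 ?AE ?AO 1?sqdistC //; lia.
  have -> : i + k%:Z + 1 = i + k.+1%:Z by lia.
  rewrite !AE; try lia.
  by rewrite -Be; first (congr (z (node _ _)); lia); lia.
have edge (j : int) : z (node j (j + 1)) = sqdist (A j) (A (j + 1)).
  (* Both sides are periodic, so one period of edges suffices. *)
  have jE : j = i + ((j - i) %% n%:Z)%Z + ((j - i) %/ n%:Z)%Z * n%:Z.
    by rewrite -addrA [X in i + X]addrC -divz_eq addrC subrK.
  rewrite jE (periodicZ (f := fun j => z (node j (j + 1))) edge_periodic).
  rewrite (periodicZ (f := fun j => sqdist (A j) (A (j + 1)))); last first.
    by move=> l /=; rewrite addrAC !per.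
  have := ltz_mod (j - i) (d := n%:Z); have := modz_ge0 (j - i) (d := n%:Z).
  case: (_ %% _)%Z => [k|k]; last by lia.
  by move=> _ kn; apply: edge_i; lia.
exists A; split; first by [].
- move=> j ij; have [->|jn] := eqVneq j (i + n%:Z).
    by rewrite per sqdistxx (CM_frieze_diagn frieze_z).
  have jE : j = i + (absz (j - i)%R)%:Z by lia.
  by rewrite jE B0 ?AE ?AO //; lia.
(* The fan stops at [i + n - 1]; the last two entries of this row are boundary values. *)
- move=> j ij; have [->|jn1] := eqVneq j (i + 1 + n%:Z).
    by rewrite per sqdistxx (CM_frieze_diagn frieze_z).
  have [->|jn] := eqVneq j (i + n%:Z).
    by rewrite node_top // per edge sqdistC.
  have jE : j = i + (absz (j - i)%R)%:Z by lia.
  by rewrite jE B1 ?AE ?A1 //; lia.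
Qed.

(** The induction carries two consecutive rows, as each step consumes both. *)
Lemma rows_from (i : int) :
  exists A, closed_polygon A /\ forall j : int, i <= j -> row A j.
Proof.
have [A [cA r0 r1]] := first_rows i; exists A; split=> // j ij.
suff rk (k : nat) : row A (i + k%:Z) /\ row A (i + k%:Z + 1).
  have -> : j = i + (absz (j - i)%R)%:Z by lia.
  by have [] := rk (absz (j - i)%R).
elim: k => [|k [IH IH1]]; first by rewrite addr0.
have -> : i + k.+1%:Z = i + k%:Z + 1 by lia.
by split=> //; apply: row_next.
Qed.

(** One periodic sequence realizes both row [i] and row [i + n]. *)
Lemma node_periodic (i j : int) : 0 <= j - i <= n%:Z ->
  z (node (i + n%:Z) (j + n%:Z)) = z (node i j).
Proof.
have [A [[per _] rA]] := rows_from i.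
by move=> ij; rewrite !rA ?per //; lia.
Qed.

Lemma rows_exist : exists A, closed_polygon A /\ forall i : int, row A i.
Proof.
have [A [cA rA]] := rows_from 0; exists A; split=> // i j ij.
have [per _] := cA.
(* Translation by [absz i] periods moves row [i] to a nonnegative row. *)
have zE : z (node i j) =
    z (node (i + (absz i)%:Z * n%:Z) (j + (absz i)%:Z * n%:Z)).
  elim: (absz i) => [|k IH]; first by rewrite mul0r !addr0.
  have shift (l : int) : l + k.+1%:Z * n%:Z = l + k%:Z * n%:Z + n%:Z.
    by rewrite intS; ring.
  by rewrite IH !shift node_periodic //; lia.
rewrite zE rA; try nia.
by rewrite !(periodicZ per).
Qed.
End Realization.

(** * From periodic sequences to polygons *)

(** The shift by one in the tuple matches residues in 1 to [n] with positions counted from 0. *)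
Lemma vertex_residue (K : comNzRingType) (n : nat) (A : int -> 'rV[K]_2) :
    (0 < n)%N -> (forall i : int, A (i + n%:Z) = A i) ->
  forall m : int,
    vertex [tuple A (k%:Z + 1) | k < n] (residue n m) = A m.
Proof.
move=> n0 per m; rewrite /vertex /residue /=.
have kn : (absz ((m - 1)%R %% n%:Z)%Z < n)%N.
  have := ltz_mod (m - 1) (d := n%:Z); have := modz_ge0 (m - 1) (d := n%:Z).
  lia.
rewrite -[absz _]/(nat_of_ord (Ordinal kn)) nth_mktuple /=.
rewrite gez0_abs; last by apply: modz_ge0; lia.
have mE : m = ((m - 1) %% n%:Z)%Z + 1 + ((m - 1) %/ n%:Z)%Z * n%:Z.
  rewrite addrAC -[LHS](subrK 1) [in LHS](divz_eq (m - 1) n%:Z).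
  by rewrite [X in X + 1]addrC.
by rewrite [in RHS]mE (periodicZ per).
Qed.

Theorem theorem5p20 (R : realType) (n : nat) (z : CM_array R[i]%C)
  (hn : (4 <= n)%N)
  (hfrieze : is_CM_frieze n z)
  (hcoherent : coherent n z)
  (hnz : forall i j : int, 2 <= j - i <= n%:Z - 2 -> z (node i j) != 0)
  (hH : forall i j : int, 2 <= j - i <= n%:Z - 1 ->
    Hpoly (z (node i j)) (z (node (i + 1) j)) (z (slash i)) != 0 /\
    Hpoly (z (node i (j - 1))) (z (node i j)) (z (backslash (j - 1))) != 0) :
  (exists P : polygon R[i]%C n, {in ICM n, z =1 frieze_of_polygon P}) /\
  (forall i j : int, 1 <= j - i <= n%:Z - 1 ->
    z (node i j) = z (node j (i + n%:Z))).
Proof.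
have [A [[per edge] rA]] := rows_exist hn hfrieze hcoherent hnz hH.
split; last first.
  (* Glide symmetry is periodicity of [A] and symmetry of the distance. *)
  by move=> i j ij; rewrite !rA ?per 1?sqdistC //; lia.
exists [tuple A (k%:Z + 1) | k < n] => -[i j|i|i] zin /=;
  rewrite !vertex_residue //; try lia.
- exact: rA.
- by rewrite (slash_node hfrieze) edge.
- by rewrite (backslash_node hfrieze) edge.
Qed.
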